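(* Let $X$ be a finite set and let $\mathscr{C}$ be a non-empty collection of subsets of $X$, each of cardinality at least $3$, with $\bigcup \mathscr{C} = X$. Then the following two statements are equivalent: (1) There exists a tree $T=(V,E)$ whose set of leaves is exactly $X$ and all of whose other vertices have degree $3$, for which the sets $\mathrm{med}_T(Y)$, $Y \in \mathscr{C}$, form a partition of the set of interior vertices of $T$; that is, $\mathrm{med}_T(Y) \cap \mathrm{med}_T(Y') = \emptyset$ for all distinct $Y, Y' \in \mathscr{C}$, and $\bigcup_{Y \in \mathscr{C}} \mathrm{med}_T(Y)$ is the set of all interior vertices of $T$. (2) For every non-empty subset $\mathscr{C}'$ of $\mathscr{C}$ we have $$\left|\bigcup \mathscr{C}'\right| - 2 \geq \sum_{Y \in \mathscr{C}'} (|Y|-2),$$ and this inequality is an equality when $\mathscr{C}' = \mathscr{C}$.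
   Context: For a collection $\mathscr{C}$ of sets, $\bigcup \mathscr{C} = \bigcup_{S \in \mathscr{C}} S$. Trees are finite. A leaf of a tree is a vertex of degree $1$; an interior vertex is a vertex that is not a leaf. Given a tree $T=(V,E)$ and a $3$-element subset $S=\{x,y,z\}$ of $V$, there is a unique vertex lying on all three of the paths in $T$ connecting $x$ and $y$, connecting $x$ and $z$, and connecting $y$ and $z$. This vertex is called the median vertex of $S$ in $T$ and is denoted $\mathrm{med}_T(S)$. For a tree $T=(V,E)$ with $X \subseteq V$ and a subset $Y$ of $X$ of cardinality at least $3$, define the set of vertices $$\mathrm{med}_T(Y) := \{\mathrm{med}_T(S) : S \subseteq Y,\ |S| = 3\}.$$ (When $|Y|=3$ this is the singleton consisting of the median vertex of $Y$.) *)

(* Defs.v *)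
From mathcomp Require Import all_boot.

Set Implicit Arguments.
Unset Strict Implicit.
Unset Printing Implicit Defensive.

Section Trees.
Variables (V : finType) (e : rel V).

(* A tree with vertex set V: its adjacency relation e is that of a simple graph
   which is connected and has no cycle. A graph cycle is a uniq cyclic sequence
   of length at least 3; the length-2 sequences [:: x; y] that [ucycle] also
   accepts merely traverse one edge back and forth. *)
Definition is_tree : Prop :=
  [/\ symmetric e, irreflexive e, 0 < #|V|,
      (forall x y, connect e x y) &
      (forall p : seq V, ucycle e p -> size p <= 2)].

Definition degree (v : V) : nat := #|[set w | e v w]|.

Definition leaves : {set V} := [set v | degree v == 1].

Definition interior : {set V} := ~: leaves.

(* x :: p is a simple path from x to y. *)
Definition path_from_to (x y : V) (p : seq V) : bool :=
  [&& path e x p, last x p == y & uniq (x :: p)].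

(* v lies on a simple path from x to y (on the path, if e is a tree). Since
   x :: p has no repetition, p has length less than #|V|, so bounding its
   length to get a boolean loses nothing; see on_pathP. *)
Definition on_path (x y v : V) : bool :=
  [exists n : 'I_#|V|, exists p : n.-tuple V,
     path_from_to x y p && (v \in x :: p)].

Lemma on_pathP (x y v : V) :
  reflect (exists2 p, path_from_to x y p & v \in x :: p) (on_path x y v).
Proof.
apply: (iffP existsP) => [[n /existsP[p /andP[xyp vp]]] | [p xyp vp]].
  by exists p.
have ltp : size p < #|V|.
  case/and3P: xyp => _ _ /card_uniqP card_xp.
  by rewrite -[_.+1]/(size (x :: p)) -card_xp max_card.
by exists (Ordinal ltp); apply/existsP; exists (in_tuple p); rewrite xyp.
Qed.

(* m = med_T(S), for S of cardinality 3; in a tree there is exactly one such m. *)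
Definition is_median (S : {set V}) (m : V) : bool :=
  [forall x in S, forall y in S, (x != y) ==> on_path x y m].

Definition med (Y : {set V}) : {set V} :=
  [set m | [exists S : {set V}, [&& S \subset Y, #|S| == 3 & is_median S m]]].

End Trees.

(* Main.v *)
(* In a tree whose interior vertices have degree 3, adding a leaf x to a set Y of
   at least two leaves adds exactly one median: the point p where x attaches to
   the hull of Y (p is not already a median of Y, since it would then have four
   branches). So |med Y| = |Y| - 2; counting medians gives (1) => (2), and in the
   converse direction turns "every interior vertex is a median" into
   disjointness.

   For (2) => (1), replacing each Y by the |Y| - 2 triples {a, b, y} for fixed
   a, b in Y preserves (2), so all sets may be taken to be triples. By counting,
   some x lies in at most two of them. If it lies in {x, a, b} only, delete this
   triple; if it also lies in B, replace both by a |: B :\ x, for a suitable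
   choice of a in {a, b} :\: B. In the tree obtained inductively, replacing the
   leaf a by a cherry {a, x} makes the former leaf the median of {x, a, b}, and
   the median of a |: B :\ x becomes that of B. *)
Require Import Defs.
From mathcomp Require Import all_boot.
From mathcomp Require Import zify.

Set Implicit Arguments.
Unset Strict Implicit.
Unset Printing Implicit Defensive.

(** * Separation of vertices in a tree, and medians expressed through it *)

Section Separation.
Variables (V : finType) (e : rel V).

Definition avoid (m u v : V) : bool := [&& u != m, v != m & e u v].
Arguments avoid m u v /.

(** In a tree this says that [m] lies strictly inside the path from [a] to [b]. Stated through
    components of the tree minus [m], it lets branches at [m] be compared by reachability. *)
Definition sep (m a b : V) : bool :=
  [&& a != m, b != m & ~~ connect (avoid m) a b].

Lemma path_avoid m a p : path e a p -> m \notin a :: p -> path (avoid m) a p.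
Proof.
elim: p a => //= b p IHp a /andP[eab ebp]; rewrite inE negb_or.
case/andP=> nma nmp; rewrite IHp //= eab eq_sym nma !andbT.
by apply: contraNneq nmp => ->; rewrite mem_head.
Qed.

Lemma path_connect_avoid m a p :
  path e a p -> m \notin a :: p -> connect (avoid m) a (last a p).
Proof. by move=> ep mp; apply/connectP; exists p; first exact: path_avoid. Qed.

Lemma avoid_path m a p : path (avoid m) a p -> path e a p && (m \notin p).
Proof.
elim: p a => //= b p IHp a /andP[/and3P[_ nbm ->] /IHp/andP[-> nmp]].
by rewrite inE negb_or eq_sym nbm.
Qed.

Lemma connect_avoid_neq m a b : connect (avoid m) a b -> a != m -> b != m.
Proof.
case/connectP=> p /avoid_path/andP[_ mp] -> am.
by apply: contraTneq (mem_last a p) => ->; rewrite inE negb_or eq_sym am.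
Qed.

Lemma sep_neq m a b : sep m a b -> a != b.
Proof. by case/and3P=> _ _; apply: contraNneq => ->. Qed.

Hypothesis e_tree : is_tree e.
Let e_sym : symmetric e. Proof. by case: e_tree. Qed.
Let e_irr : irreflexive e. Proof. by case: e_tree. Qed.
Let e_conn x y : connect e x y. Proof. by case: e_tree => _ _ _ ->. Qed.

Lemma avoid_sym m : connect_sym (avoid m).
Proof. by apply: sym_connect_sym => u v; rewrite /= e_sym andbCA. Qed.

Lemma sepC m a b : sep m a b = sep m b a.
Proof. by rewrite /sep avoid_sym andbCA. Qed.

(** Two distinct neighbours of [m] joined by a path avoiding [m] would close a cycle through [m]. *)
Lemma nbr_connect_inj m a b :
  e m a -> e m b -> connect (avoid m) a b -> a = b.
Proof.
move=> ema emb /connectP[p /shortenP[q ep uq _] eb].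
have /andP[eq mq] := avoid_path ep.
have nam : a != m by apply: contraTneq ema => ->; rewrite e_irr.
have [_ _ _ _ /(_ (m :: a :: q))] := e_tree.
rewrite /ucycle /= rcons_path ema eq -eb e_sym emb /=.
move: uq; rewrite !inE !negb_or eq_sym nam mq /= => -> /(_ isT).
by rewrite eb; case: {+}q.
Qed.

Lemma sep_on_path m a b : sep m a b -> on_path e a b m.
Proof.
case/and3P=> am bm /negP nab; have /connectP[p ep eb] := e_conn a b.
move: ep eb nab => /shortenP[q eq uq _] -> nab.
apply/on_pathP; exists q; first by rewrite /path_from_to eq uq eqxx.
by apply: contra_notT nab => /path_connect_avoid; apply.
Qed.

(** The path enters and leaves [m] by different neighbours. If [a] and [b] were connected off [m],
    so would be these two, against [nbr_connect_inj]. *)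
Lemma on_path_sep m a b : on_path e a b m -> a != m -> b != m -> sep m a b.
Proof.
case/on_pathP=> p /and3P[ep /eqP eb up] mp am bm; rewrite /sep am bm /=.
move: mp; rewrite inE eq_sym (negPf am) /= => mp.
case/splitPr: mp ep eb up => p1 [|c p2].
  by rewrite last_cat /= => _ eb; rewrite eb eqxx in bm.
rewrite cat_path last_cat -cat_cons cat_uniq.
case/and4P=> ep1 e1m emc ep2 /= eb /and3P[_ /norP[m1 /norP[c1 _]]].
case/and3P; rewrite inE => /norP[mc m2] _ _.
apply/negP => cab; have c2 := path_connect_avoid ep2.
have {c2} c2: connect (avoid m) c b by rewrite -eb c2 // inE negb_or mc.
have cc : connect (avoid m) (last a p1) c.
  rewrite avoid_sym in c2; apply: connect_trans c2.
  apply: connect_trans cab; rewrite avoid_sym; exact: path_connect_avoid.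
rewrite e_sym in e1m; have ec := nbr_connect_inj e1m emc cc.
by rewrite -ec mem_last in c1.
Qed.

Lemma connect_avoid_nbr m a :
  a != m -> exists2 b, e m b & connect (avoid m) a b.
Proof.
move=> am; have /connectP[p] := e_conn a m.
elim: p a am => /= [a am _ em|b p IHp a am /andP[eab ep] em].
  by rewrite em eqxx in am.
have [bm|bm] := eqVneq b m; first by exists a; rewrite // e_sym -bm.
have [c emc cbc] := IHp b bm ep em; exists c => //.
by apply: connect_trans cbc; apply: connect1; rewrite /= am bm.
Qed.

(** Along a path from [p] to [z], reachability passes to the next vertex unless that is [p] or [q],
    where an empty path takes over. *)
Lemma connect_avoid_total p q z : p != q ->
  connect (avoid p) q z || connect (avoid q) p z.
Proof.
move=> npq; have /connectP[s es ->] := e_conn p z; elim/last_ind: s es => /=.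
  by rewrite connect0 orbT.
move=> s t IHs; rewrite rcons_path last_rcons => /andP[/IHs/orP[] cs est].
  have [->|ntp] := eqVneq t p; first by rewrite connect0 orbT.
  apply/orP; left; apply: (connect_trans cs (connect1 _)).
  by rewrite /= ntp est (connect_avoid_neq cs) // eq_sym.
have [->|ntq] := eqVneq t q; first by rewrite connect0.
apply/orP; right; apply: (connect_trans cs (connect1 _)).
by rewrite /= ntq est (connect_avoid_neq cs).
Qed.

(** A path from [p] to [z] off [q] starts with a neighbour of [p] other than [q], yet in the same
    component of the tree minus [p] as [q]. *)
Lemma connect_avoid_edge p q z :
  e p q -> connect (avoid p) q z -> connect (avoid q) p z -> False.
Proof.
move=> epq cz; have npq : q != p by apply: contraTneq epq => ->; rewrite e_irr.
have zp := connect_avoid_neq cz npq.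
case/connectP=> s /shortenP[[|a r] es us _] ez.
  by rewrite ez eqxx in zp.
have /andP[/= /andP[epa er]] := avoid_path es.
rewrite inE => /norP[nqa nqr]; case/andP: us => pa _.
have ca : connect (avoid p) a z by rewrite ez; apply: path_connect_avoid.
have cqa : connect (avoid p) q a by rewrite (connect_trans cz) // avoid_sym.
by rewrite (nbr_connect_inj epq epa cqa) eqxx in nqa.
Qed.

Lemma leaf_connect m a b :
  m \in leaves e -> a != m -> b != m -> connect (avoid m) a b.
Proof.
rewrite inE => /cards1P[c ec] am bm.
have [a' ea ca] := connect_avoid_nbr am; have [b' eb cb] := connect_avoid_nbr bm.
have: a' \in [set w | e m w] by rewrite inE.
have: b' \in [set w | e m w] by rewrite inE.
rewrite ec !inE => /eqP eb' /eqP ea'; rewrite -ea' in eb'; rewrite eb' in cb.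
by apply: connect_trans ca _; rewrite avoid_sym.
Qed.

Lemma leaf_not_sep m a b : m \in leaves e -> ~~ sep m a b.
Proof.
by move=> lm; apply/negP=> /and3P[am bm]; rewrite leaf_connect.
Qed.

(** The median is outside [S]: being a leaf, it could not separate two other members. Hence
    [on_path] strengthens to [sep]. *)
Lemma is_medianP (S : {set V}) m : S \subset leaves e -> 2 < #|S| ->
  reflect {in S &, forall a b, a != b -> sep m a b} (is_median e S m).
Proof.
move=> lS S3.
have pathm a b : sep m a b -> on_path e a b m by apply: sep_on_path.
apply: (iffP forall_inP) => [mS | mS a aS]; last first.
  by apply/forall_inP=> b bS; apply/implyP=> nab; apply/pathm/mS.
have mP a b : a \in S -> b \in S -> a != b -> on_path e a b m.
  by move=> aS bS; apply/implyP; apply: (forall_inP (mS a aS)).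
suff mNS : m \notin S.
  move=> a b aS bS nab; apply: on_path_sep (mP _ _ aS bS nab) _ _.
    by apply: contraNneq mNS => <-.
  by apply: contraNneq mNS => <-.
apply/negP=> mS'; have: 1 < #|S :\ m| by rewrite (cardsD1 m) mS' in S3.
case/card_gt1P=> a [b [/setD1P[am aS] /setD1P[bm bS] nab]].
have := on_path_sep (mP _ _ aS bS nab) am bm.
by apply/negP/leaf_not_sep/(subsetP lS).
Qed.

Lemma medP (Y : {set V}) m : Y \subset leaves e ->
  reflect (exists a b c, [/\ a \in Y, b \in Y, c \in Y &
                             [/\ sep m a b, sep m a c & sep m b c]])
          (m \in med e Y).
Proof.
move=> lY; rewrite inE; apply: (iffP existsP).
  case=> S /and3P[SY /eqP S3].
  move/is_medianP=> /(_ (subset_trans SY lY)); rewrite S3 => /(_ isT) mS.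
  have /card_gt2P[a [b [c [[aS bS cS] [ab bc ca]]]]] : 2 < #|S| by rewrite S3.
  exists a, b, c; rewrite !(subsetP SY) //; split=> //.
  by split; apply: mS => //; rewrite eq_sym.
case=> a [b [c [aY bY cY [ab ac bc]]]]; exists [set a; b; c].
have SY : [set a; b; c] \subset Y.
  by apply/subsetP=> z; rewrite !inE -orbA => /or3P[] /eqP->.
have S3 : #|[set a; b; c]| = 3.
  rewrite setUC cardsU1 cards2 !inE (sep_neq ab) negb_or.
  by rewrite eq_sym (sep_neq ac) eq_sym (sep_neq bc).
rewrite SY S3 eqxx; apply/is_medianP; rewrite ?S3 ?(subset_trans SY) //.
move=> u v; rewrite !inE -!orbA.
move=> /or3P[]/eqP-> /or3P[]/eqP->; rewrite ?eqxx // => _ //; by rewrite sepC.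
Qed.

Lemma medS (Y Z : {set V}) : Y \subset Z -> med e Y \subset med e Z.
Proof.
move=> YZ; apply/subsetP=> m; rewrite !inE => /existsP[S /andP[SY mS]].
by apply/existsP; exists S; rewrite (subset_trans SY).
Qed.

Lemma med_sub_interior (Y : {set V}) :
  Y \subset leaves e -> med e Y \subset interior e.
Proof.
move=> lY; apply/subsetP=> m /(medP _ lY)[a [b [_ [_ _ _ [mab _ _]]]]].
by rewrite in_setC; apply: contraL mab => /leaf_not_sep->.
Qed.

Lemma med_eq0 (Y : {set V}) : Y \subset leaves e -> #|Y| <= 2 -> med e Y = set0.
Proof.
move=> lY Y2; apply/eqP; rewrite -subset0; apply/subsetP=> m.
case/(medP _ lY)=> a [b [c [aY bY cY [ab ac bc]]]].
suff: 2 < #|Y| by rewrite ltnNge Y2.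
apply/card_gt2P; exists a, b, c; split=> //; split; rewrite ?(sep_neq ab) //.
  exact: sep_neq bc.
by rewrite eq_sym; apply: sep_neq ac.
Qed.

(** * Counting medians in a tree of maximum degree three *)

Hypothesis deg_le3 : forall v, degree e v <= 3.

(** Pairwise separated vertices are reached from [m] through distinct neighbours. *)
Lemma four_branches m a b c d : sep m a b -> sep m a c -> sep m b c ->
  sep m d a -> sep m d b -> sep m d c -> False.
Proof.
move=> ab ac bc da db dc; have := deg_le3 m; rewrite leqNgt => /negP; apply.
have [am bm _] := and3P ab; have [dm cm _] := and3P dc.
have [a' ea ca] := connect_avoid_nbr am; have [b' eb cb] := connect_avoid_nbr bm.
have [c' ec cc] := connect_avoid_nbr cm; have [d' ed cd] := connect_avoid_nbr dm.
have neq u v u' v' : sep m u v -> connect (avoid m) u u' ->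
    connect (avoid m) v v' -> u' != v'.
  case/and3P=> _ _ nuv cu cv; apply: contraNneq nuv => euv.
  by apply: connect_trans cu _; rewrite avoid_sym euv.
have us : uniq [:: d'; a'; b'; c'].
  rewrite /= !inE !negb_or (neq _ _ _ _ da cd ca) (neq _ _ _ _ db cd cb).
  rewrite (neq _ _ _ _ dc cd cc) (neq _ _ _ _ ab ca cb).
  by rewrite (neq _ _ _ _ ac ca cc) (neq _ _ _ _ bc cb cc).
rewrite -[4]/(size [:: d'; a'; b'; c']) -(card_uniqP us).
apply/subset_leq_card/subsetP=> z.
by rewrite !inE => /or4P[] /eqP->.
Qed.

Definition hull (Y : {set V}) : {set V} :=
  [set v | [exists y in Y, exists z in Y, on_path e y z v]].

Lemma hullP (Y : {set V}) v :
  reflect (exists y z, [/\ y \in Y, z \in Y & on_path e y z v]) (v \in hull Y).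
Proof.
rewrite inE; apply: (iffP exists_inP) => [[y yY /exists_inP[z zY yzv]]|].
  by exists y, z.
by case=> y [z [yY zY yzv]]; exists y => //; apply/exists_inP; exists z.
Qed.

Lemma on_path0 x : on_path e x x x.
Proof. by apply/on_pathP; exists [::]; rewrite ?inE /path_from_to /= ?eqxx. Qed.

Lemma mem_hull (Y : {set V}) y : y \in Y -> y \in hull Y.
Proof. by move=> yY; apply/hullP; exists y, y; rewrite on_path0. Qed.

(** On a path from [x] to [y], [p] is the first vertex in [H] and [q] its predecessor; the segment
    up to [q] stays outside [H]. *)
Lemma first_entry (H : {set V}) x y : x \notin H -> y \in H ->
  exists q p, [/\ q \notin H, p \in H, e q p &
                  forall m, m \in H -> connect (avoid m) x q].
Proof.
have /connectP[s] := e_conn x y; elim: s x => /= [x _ -> /negP //|a s IHs x].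
case/andP=> exa es ey xH yH; have [aH|aH] := boolP (a \in H).
  by exists x, a.
have [q [p [qH pH eqp cq]]] := IHs a es ey aH yH.
exists q, p; split=> // m mH; apply: connect_trans (connect1 _) (cq m mH).
by by rewrite /= exa andbT; apply/andP; split; apply: contraTneq mH => <-.
Qed.

Lemma med_add_leaf (Y : {set V}) x : x |: Y \subset leaves e -> x \notin Y ->
  1 < #|Y| -> exists2 p, p \notin med e Y & med e (x |: Y) = p |: med e Y.
Proof.
move=> lxY xY Y2; have lx : x \in leaves e by rewrite (subsetP lxY) ?setU11.
have lY : Y \subset leaves e by apply: subset_trans lxY; apply: subsetUr.
have [y0 y0Y] : exists y, y \in Y by apply/card_gt0P; apply: ltn_trans Y2.
have xH : x \notin hull Y.
  apply/negP=> /hullP[y [z [yY zY yzx]]].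
  have /negP[] := leaf_not_sep y z lx; apply: on_path_sep yzx _ _.
    by apply: contraNneq xY => <-.
  by apply: contraNneq xY => <-.
have [q [p [qH pH eqp cq]]] := first_entry xH (mem_hull y0Y).
have epq : e p q by rewrite e_sym.
have cpx := cq p pH.
have xp : x != p by apply: contraNneq xH => ->.
have qp : q != p by apply: contraNneq qH => ->.
(* No member of [Y] is on the branch of [q] at [p]: otherwise [q] would separate it from a member
   [y1] on another side of [p], or equal to [p], and so lie in the hull. *)
have gate y : y \in Y -> ~~ connect (avoid p) q y.
  move=> yY; apply/negP=> cy.
  have qNY z : z \in Y -> z != q.
    by move=> zY; apply: contraNneq qH => <-; apply: mem_hull.
  have [y1 y1Y ny1] : exists2 y1, y1 \in Y & ~~ connect (avoid p) q y1.
    have [y1 [y2 [y1Y y2Y y12p]]] := hullP _ _ pH.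
    have [e1|n1] := eqVneq y1 p.
      exists y1 => //; apply: contraTN isT => /connect_avoid_neq/(_ qp).
      by rewrite e1 eqxx.
    have [e2|n2] := eqVneq y2 p.
      exists y2 => //; apply: contraTN isT => /connect_avoid_neq/(_ qp).
      by rewrite e2 eqxx.
    have /and3P[_ _ n12] := on_path_sep y12p n1 n2.
    have [c1|] := boolP (connect (avoid p) q y1); last by exists y1.
    exists y2 => //; apply: contra n12 => c2; apply: connect_trans c2.
    by rewrite avoid_sym.
  have cqy1 : connect (avoid q) p y1.
    have npq : p != q by rewrite eq_sym.
    by have := connect_avoid_total y1 npq; rewrite (negPf ny1).
  case/negP: qH; apply/hullP; exists y1, y; split=> //; apply: sep_on_path.
  rewrite /sep !qNY //=; apply/negP=> c1y.
  exact: connect_avoid_edge epq cy (connect_trans cqy1 c1y).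
(* As a leaf, [p] would have a single branch, shared by [q] and the rest of [Y]. *)
have pY : p \notin Y.
  apply/negP=> pY; have lp := subsetP lY _ pY.
  have [y /setD1P[yp yY]] : exists y, y \in Y :\ p.
    by apply/card_gt0P; rewrite (cardsD1 p) pY in Y2.
  by have /negP := gate y yY; apply; apply: leaf_connect.
have Yp y : y \in Y -> y != p by move=> yY; apply: contraNneq pY => <-.
have sepx y : y \in Y -> sep p x y.
  move=> yY; rewrite /sep xp Yp //=; apply: contra (gate y yY).
  by apply: connect_trans; rewrite avoid_sym.
have [y1 [y2 [y1Y y2Y y12p]]] := hullP _ _ pH.
have sep12 := on_path_sep y12p (Yp _ y1Y) (Yp _ y2Y).
exists p.
  apply/negP=> /(medP _ lY)[a [b [c [aY bY cY [ab ac bc]]]]].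
  by apply: four_branches ab ac bc (sepx a aY) (sepx b bY) (sepx c cY).
apply/eqP; rewrite eqEsubset subUset (medS (subsetUr _ _)) andbT sub1set.
apply/andP; split; last first.
  apply/(medP _ lxY); exists x, y1, y2; rewrite !inE eqxx y1Y y2Y !orbT.
  by rewrite !sepx.
(* Seen from a median [m] other than [p], the leaf [x] is on the branch of [p], which also contains
   some [t] in [Y]; this [t] can stand in for [x]. *)
have new m y z : y \in Y -> z \in Y -> sep m x y -> sep m x z -> sep m y z ->
    m \in p |: med e Y.
  move=> yY zY xy xz yz; rewrite in_setU1; apply/predU1P.
  have [|mp] := eqVneq m p; [by left | right].
  have mH : m \in hull Y by apply/hullP; exists y, z; rewrite sep_on_path.
  have [qm pm] : q != m /\ p != m.
    by split; [apply: contraNneq qH => -> | rewrite eq_sym].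
  have cxp : connect (avoid m) x p.
    by apply: connect_trans (cq m mH) (connect1 _); rewrite /= qm pm.
  have [t tY cpt] : exists2 t, t \in Y & connect (avoid m) p t.
    have := connect_avoid_total y1 mp; case/orP=> c1; first by exists y1.
    have := connect_avoid_total y2 mp; case/orP=> c2; first by exists y2.
    have /and3P[_ _ /negP[]] := sep12.
    by apply: connect_trans c2; rewrite avoid_sym.
  have cxt := connect_trans cxp cpt.
  have [xm ym nxy] := and3P xy; have [_ zm nxz] := and3P xz.
  have septx w : sep m x w -> sep m t w.
    case/and3P=> _ wm nxw; rewrite /sep wm (connect_avoid_neq cxt) //=.
    by apply: contra nxw; apply: connect_trans.
  by apply/(medP _ lY); exists t, y, z; split=> //; split=> //; apply: septx.
apply/subsetP=> m /(medP _ lxY)[a [b [c [/setU1P aY /setU1P bY /setU1P cY [ab ac bc]]]]].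
have neqx u v : sep m u v -> u = x -> v = x -> False.
  by move=> /sep_neq/eqP nuv eu ev; apply: nuv; rewrite eu.
case: aY => [ax|aY].
  case: bY cY => [/(neqx _ _ ab ax)//|bY] [/(neqx _ _ ac ax)//|cY].
  by apply: (new m b c bY cY); rewrite // -ax.
case: bY => [bx|bY].
  case: cY => [/(neqx _ _ bc bx)//|cY].
  by apply: (new m a c aY cY); rewrite // -bx // sepC.
case: cY => [cx|cY]; first by apply: (new m a b aY bY); rewrite // -cx sepC.
rewrite in_setU1; apply/orP; right; apply/(medP _ lY).
by exists a, b, c.
Qed.

(** Each leaf after the second adds one median; truncated subtraction covers the smaller sets. *)
Lemma card_med (Y : {set V}) : Y \subset leaves e -> #|med e Y| = #|Y| - 2.
Proof.
elim: {Y}#|Y| {-2}Y (erefl #|Y|) => [|n IHn] Y cY lY.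
  by rewrite med_eq0 ?cards0 ?cY.
have [Y2|Y2] := leqP #|Y| 2.
  by rewrite med_eq0 // cards0; apply/esym/eqP; rewrite subn_eq0.
have [x xY] : exists x, x \in Y by apply/card_gt0P; rewrite cY.
have cYx : #|Y :\ x| = n by move: cY; rewrite (cardsD1 x) xY => -[].
rewrite -(setD1K xY) in lY *.
have lYx : Y :\ x \subset leaves e := subset_trans (subsetUr _ _) lY.
have [||p pY ->] := med_add_leaf lY; [by rewrite setD11 | by lia |].
by rewrite cardsU1 pY IHn // setD1K // cY cYx; lia.
Qed.

End Separation.

(** * Replacing a leaf by a cherry *)

Section Cherry.
Variables (V : finType) (e : rel V) (l : V).

(** The two elements of [bool] are new leaves attached to [l]. *)
Definition cherry (x y : V + bool) : bool :=
  match x, y with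
  | inl u, inl v => e u v
  | inl u, inr _ => u == l
  | inr _, inl v => v == l
  | inr _, inr _ => false
  end.

Definition cherry_base (x : V + bool) : V := if x is inl u then u else l.

(** A cycle through a new leaf would have [l] on both sides of it; any other cycle lies in [e]. *)
Lemma cherry_tree : is_tree e -> is_tree cherry.
Proof.
case=> e_sym e_irr V0 e_conn e_acyc.
have c_sym : symmetric cherry by move=> [u|b] [v|c] /=.
have c_conn x : connect cherry x (inl l).
  case: x => [u|b]; last by apply: connect1; rewrite /= eqxx.
  have /connectP[p ep el] := e_conn u l; apply/connectP; exists (map inl p).
    by rewrite path_map.
  by rewrite last_map -el.
split=> [//|[u|b] //=||x y|p]; rewrite ?e_irr //.
- by rewrite card_sum card_bool addn2.
- by apply: connect_trans (c_conn x) _; rewrite sym_connect_sym.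
have [/hasP[[//|b] bp _]|] := boolP (has (fun x => if x is inr _ then true else false) p).
  have [i q eq] := rot_to bp; rewrite -(rot_ucycle i) -(size_rot i) eq.
  case: q {eq} => [//|c q]; rewrite /ucycle /= rcons_path.
  case: c => [c|//] /andP[/and3P[/eqP-> _]].
  case/lastP: q => // q d; rewrite last_rcons => dl /and3P[_ lq _].
  by case: d dl lq => //= d /eqP->; rewrite mem_rcons mem_head.
rewrite -all_predC => /allP p_inl.
have [q ->] : exists q, p = map inl q.
  elim: p p_inl => [|[u|b] p IHp] p_inl; first by exists [::].
    have [z zp|q ->] := IHp; first by apply: p_inl; rewrite inE zp orbT.
    by exists (u :: q).
  by have := p_inl (inr b) (mem_head _ _).
rewrite size_map /ucycle map_inj_uniq; last by move=> ? ? [].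
case/andP=> cq uq; apply: e_acyc; rewrite /ucycle uq andbT.
by case: q cq {uq p_inl} => //= u q; rewrite -map_rcons path_map.
Qed.

Lemma degree_cherry_inl v : degree cherry (inl v) = degree e v + (v == l).*2.
Proof.
rewrite /degree !cardsE -!sum1_card !big_mkcond big_sumType /=.
congr (_ + _); first by rewrite [RHS]big_mkcond.
by rewrite big_bool !unfold_in /=; case: (v == l).
Qed.

Lemma degree_cherry_inr b : degree cherry (inr b) = 1.
Proof.
rewrite /degree (_ : [set w | _] = [set inl l]) ?cards1 //.
by apply/setP=> -[v|c]; rewrite !inE.
Qed.

Lemma mem_leaves_cherry x :
  (x \in leaves cherry) = if x is inl v then (v != l) && (v \in leaves e) else true.
Proof.
case: x => [v|b]; rewrite !inE; last by rewrite degree_cherry_inr.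
by rewrite degree_cherry_inl; case: (v == l); rewrite ?addn0 ?addn2.
Qed.

(** Contracting the cherry to [l] by [cherry_base] turns a path avoiding [inl m] into a walk
    avoiding [m], because [m] is not [l]. *)
Lemma sep_cherry m x y : m != l ->
  sep e m (cherry_base x) (cherry_base y) -> sep cherry (inl m) x y.
Proof.
move=> ml /and3P[xm ym nxy]; rewrite /sep.
have neq z : cherry_base z != m -> z != inl m.
  by apply: contraNneq => ->; rewrite /= eqxx.
rewrite !neq //=; apply: contra nxy => /connectP[p cp ->] {ym neq}; rewrite eq_sym in ml.
elim: p x xm cp => //= z p IHp x xm /andP[/and3P[_ znm cxz] cp].
have zm : cherry_base z != m by case: z znm {cxz cp} => [v|[]].
apply: connect_trans (IHp z zm cp).
case: x z cxz xm zm {znm cp} => [u|b] [v|c] //= => [euv um vm|/eqP->|/eqP->] //.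
by apply: connect1; rewrite /avoid um vm.
Qed.

Lemma sep_cherry_leaf b y : y != inl l -> y != inr b -> sep cherry (inl l) (inr b) y.
Proof.
move=> yl yb; rewrite /sep yl /=; apply/negP=> /connectP[[|z p] /=].
  by move=> _ ey; rewrite ey eqxx in yb.
case: z => [z|c] /andP[/and3P[_ zl /= zE]] //.
by rewrite (eqP zE) eqxx in zl.
Qed.

End Cherry.

(** * Realizing sparse triple systems by trees *)

Section Realization.
Variable X : finType.
Implicit Types (Z t : {set X}) (C D S : {set {set X}}).

(** The invariant of the induction, in which [Z] shrinks. It only asks that every interior vertex be
    a median of a member of [C]; disjointness is recovered later by counting. *)
Definition realizes Z C : Prop :=
  exists (V : finType) (e : rel V) (lab : X -> V),
    [/\ is_tree e, {in Z &, injective lab}, leaves e = lab @: Z,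
        (forall v, v \notin leaves e -> degree e v = 3) &
        (forall v, v \in interior e -> exists2 t, t \in C &
           {in t &, forall a b, a != b -> sep e v (lab a) (lab b)})].

(** The leaf of [a] becomes a cherry carrying [a] and [x], and the former leaf becomes the median of
    [A]. A member [t] of [C1] outside [C] comes from a member of [C] by renaming [x] to [a]. *)
Lemma realizes_cherry Z C C1 x a A :
  x \in Z -> a \in Z -> a != x -> A \in C -> #|A| = 3 -> x \in A -> a \in A ->
  A \subset Z ->
  (forall t, t \in C1 -> t \subset Z :\ x) ->
  (forall t, t \in C1 ->
     t \in C \/ a \in t /\ x |: t :\ a \in C) ->
  realizes (Z :\ x) C1 -> realizes Z C.
Proof.
move=> xZ aZ nax AC A3 xA aA AZ C1Z C1C [V [e [lab]]].
case=> e_tree lab_inj leaves_lab deg3 meds.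
pose lab' z := if z == x then inr false
  else if z == a then inr true else inl (lab z) : V + bool.
have labx : lab' x = inr false by rewrite /lab' eqxx.
have laba : lab' a = inr true by rewrite /lab' (negPf nax) eqxx.
have labo z : z != x -> z != a -> lab' z = inl (lab z).
  by rewrite /lab' => /negPf-> /negPf->.
have aZx : a \in Z :\ x by rewrite !inE nax.
have la : lab a \in leaves e by rewrite leaves_lab imset_f.
have lab_a z : z \in Z -> z != x -> z != a -> lab z != lab a.
  by move=> zZ zx; apply: contraNneq => /lab_inj-> //; rewrite !inE zx.
have lab'_inj : {in Z &, injective lab'}.
  move=> z w zZ wZ; rewrite /lab'.
  case: (eqVneq z x) (eqVneq w x) => [->|zx] [->|wx] //; try by case: ifP.
  case: (eqVneq z a) (eqVneq w a) => [->|za] [->|wa] // [].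
  by apply: lab_inj; rewrite !inE ?zx ?wx.
exists (V + bool)%type, (cherry e (lab a)), lab'; split.
- exact: cherry_tree.
- exact: lab'_inj.
- apply/setP=> v; rewrite mem_leaves_cherry; case: v => [v|b]; last first.
    by symmetry; apply/imsetP; case: b; [exists a | exists x].
  rewrite leaves_lab; apply/andP/imsetP=> [[va]|[z zZ]].
    case/imsetP=> z /setD1P[zx zZ] ev; exists z; rewrite // labo ?ev //.
    by apply: contraNneq va => <-; rewrite ev.
  rewrite /lab'; case: (eqVneq z x) => // zx; case: (eqVneq z a) => // za [->].
  by rewrite lab_a // imset_f // !inE zx.
- case=> [v|b]; rewrite mem_leaves_cherry // negb_and negbK degree_cherry_inl.
  have [->|va /= /deg3->//] := eqVneq v (lab a).
  by move: la; rewrite inE => /eqP->.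
case=> [v|b]; rewrite in_setC mem_leaves_cherry // negb_and negbK.
have [-> _|va /= vl] := eqVneq v (lab a).
  exists A => // u w uA wA nuw.
  have lab'l z : z \in A -> lab' z != inl (lab a).
    move=> zA; rewrite /lab'; case: (eqVneq z x) => // zx.
    case: (eqVneq z a) => // za.
    by rewrite (inj_eq inl_inj) lab_a // (subsetP AZ).
  have lab'n : lab' u != lab' w.
    by apply: contraNneq nuw => /lab'_inj->; rewrite ?(subsetP AZ).
  (* Since [A] has three elements and contains [x] and [a], one of [u], [w] is [x] or [a], hence a
     new leaf. *)
  have [b [eu|ew]] : exists b, lab' u = inr b \/ lab' w = inr b.
    rewrite /lab'; case: (eqVneq u x) => [_|ux]; first by exists false; left.
    case: (eqVneq u a) => [_|ua]; first by exists true; left.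
    case: (eqVneq w x) => [_|wx]; first by exists false; right.
    case: (eqVneq w a) => [_|wa]; first by exists true; right.
    suff: 4 <= #|A| by rewrite A3.
    have us : uniq [:: u; w; x; a].
      by rewrite /= !inE !negb_or nuw ux ua wx wa eq_sym nax.
    rewrite -[4]/(size [:: u; w; x; a]) -(card_uniqP us).
    by apply/subset_leq_card/subsetP=> z; rewrite !inE => /or4P[]/eqP->.
  - by rewrite eu; apply: sep_cherry_leaf; rewrite ?lab'l // -eu eq_sym.
  by rewrite sepC ?ew; [apply: sep_cherry_leaf; rewrite ?lab'l // -ew | apply: cherry_tree].
have baseE z : cherry_base (lab a) (lab' z) = if z == x then lab a else lab z.
  by rewrite /lab'; case: (eqVneq z x) => // zx; case: (eqVneq z a) => //= ->.
have [|t tC1 mt] := meds v; first by rewrite in_setC.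
case: (C1C t tC1) => [tC|[at_ BC]].
  exists t => // u w ut wt nuw; apply: sep_cherry => //.
  have := subsetP (C1Z t tC1) _ ut; have := subsetP (C1Z t tC1) _ wt.
  by rewrite !inE !baseE => /andP[/negPf-> _] /andP[/negPf-> _]; apply: mt.
exists (x |: t :\ a) => // u w uB wB nuw; apply: sep_cherry => //.
have xt : x \notin t by apply/negP=> /(subsetP (C1Z t tC1)); rewrite !inE eqxx.
(* On labels, contracting the cherry amounts to renaming [x] to [a]. *)
pose r z := if z == x then a else z.
have rE z : cherry_base (lab a) (lab' z) = lab (r z).
  by rewrite baseE /r; case: ifP.
have rt z : z \in x |: t :\ a -> r z \in t.
  by rewrite !inE /r; case: eqP => //= _ /andP[].
rewrite !rE; apply: mt; rewrite ?rt //.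
move: uB wB nuw; rewrite !inE /r.
case: (eqVneq u x) (eqVneq w x) => [->|ux] [->|wx] //=.
  by move=> _ /andP[wa _] _; rewrite eq_sym.
by move=> /andP[].
Qed.

(** Inequality (2) for triples, where each |Y| - 2 is 1, written additively to avoid truncated
    subtraction. *)
Definition sparse C := forall D, D \subset C -> D != set0 -> #|D| + 2 <= #|cover D|.

Lemma sparse_sub C D : D \subset C -> sparse C -> sparse D.
Proof. by move=> DC spC S SD; apply: spC; apply: subset_trans SD DC. Qed.

Lemma coverU C D : cover (C :|: D) = cover C :|: cover D.
Proof. exact: bigcup_setU. Qed.

Lemma cover_setU1 t C : cover (t |: C) = t :|: cover C.
Proof. by rewrite coverU cover1. Qed.

Lemma subset_cover C D : C \subset D -> cover C \subset cover D.
Proof.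
move=> CD; apply/bigcupsP=> t tC; apply: bigcup_sup; exact: (subsetP CD).
Qed.

(** Submodularity: the covers share at least |S ∩ S'| + 2 points, by sparsity, or by the last
    hypothesis when [S] and [S'] are disjoint. *)
Lemma tight_setU C S S' : sparse C -> S \subset C -> S' \subset C ->
  #|cover S| <= #|S| + 2 -> #|cover S'| <= #|S'| + 2 ->
  1 < #|cover S :&: cover S'| -> #|cover (S :|: S')| <= #|S :|: S'| + 2.
Proof.
move=> spC SC S'C tS tS' meet2.
have cI : #|S :&: S'| + 2 <= #|cover S :&: cover S'|.
  have [->|SS'0] := eqVneq (S :&: S') set0; first by rewrite cards0.
  apply: leq_trans (spC _ _ SS'0) _; first exact: subset_trans (subsetIl _ _) SC.
  by apply: subset_leq_card; rewrite subsetI !subset_cover ?subsetIl ?subsetIr.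
have := cardsUI S S'; have := cardsUI (cover S) (cover S'); rewrite coverU; lia.
Qed.

(* Otherwise every t' = a |: B :\ x is blocked by a tight subfamily, and the
   union of these is a tight subfamily whose union contains A :\ x and B :\ x, so
   that adding A and B to it, which only adds the point x, breaks sparsity. *)
Lemma sparse_merge C A B x : sparse C -> A \in C -> B \in C -> A != B ->
  #|A| = 3 -> #|B| = 3 -> x \in A -> x \in B ->
  exists2 a, a \in A :\: B &
    forall S, S \subset C :\ A :\ B ->
      #|S| + 3 <= #|cover S :|: (a |: B :\ x)|.
Proof.
move=> spC AC BC nAB A3 B3 xA xB; set C0 := C :\ A :\ B.
have C0C : C0 \subset C by apply: subset_trans (subsetDl _ _) (subsetDl _ _).
have B2 : #|B :\ x| = 2 by move: B3; rewrite (cardsD1 x) xB => -[].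
have block a : a \in A :\: B ->
  (forall S, S \subset C0 -> #|S| + 3 <= #|cover S :|: (a |: B :\ x)|) \/
  (exists S, [/\ S \subset C0, #|cover S| <= #|S| + 2 & a |: B :\ x \subset cover S]).
  move=> /setDP[aA aB].
  case: (boolP [forall S : {set {set X}}, (S \subset C0) ==>
                  (#|S| + 3 <= #|cover S :|: (a |: B :\ x)|)]).
    by move=> /forallP good; left=> S SC0; apply: (implyP (good S)).
  rewrite negb_forall => /existsP[S]; rewrite negb_imply -ltnNge addnS ltnS.
  case/andP=> SC0 le2; right; exists S; split=> //.
    by apply: leq_trans le2; apply/subset_leq_card/subsetUl.
  (* The empty family cannot block, as the merged triple alone has three points. For other [S],
     sparsity leaves no room for the triple to enlarge the cover. *)
  have [S0|S0] := eqVneq S set0.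
    move: le2; rewrite S0 cards0 => /(leq_trans (subset_leq_card (subsetUr _ _))).
    rewrite cardsU1 !inE (negPf aB) andbF /=.
    by rewrite B2.
  have := spC S (subset_trans SC0 C0C) S0 => ge2.
  apply/setUidPl/esym/eqP; rewrite eqEcard subsetUl /=.
  exact: leq_trans le2 ge2.
have final S : S \subset C0 -> #|cover S| <= #|S| + 2 ->
    A :\ x \subset cover S -> B :\ x \subset cover S -> False.
  move=> SC0 tS AS BS.
  have BS0 : B \notin S by apply/negP=> /(subsetP SC0); rewrite !inE eqxx.
  have AS0 : A \notin B |: S.
    rewrite !inE (negPf nAB) /=; apply/negP=> /(subsetP SC0).
    by rewrite !inE eqxx andbF.
  have DC : A |: (B |: S) \subset C.
    by rewrite !subUset !sub1set AC BC (subset_trans SC0).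
  have D0 : A |: (B |: S) != set0 by apply/set0Pn; exists A; rewrite setU11.
  have := spC _ DC D0; rewrite !cardsU1 AS0 BS0 !cover_setU1.
  have : A :|: (B :|: cover S) \subset x |: cover S.
    rewrite -(setD1K xA) -(setD1K xB) !subUset !subsetUl !subsetUr.
    by rewrite !(subset_trans _ (subsetUr _ _)).
  move/subset_leq_card; rewrite cardsU1.
  by move: #|cover S| #|_ :|: _| #|S| tS (x \notin _); clear => m n k mk [] /=; lia.
have [a /setDP[aA aB]] : exists a, a \in A :\: B.
  by apply/set0Pn; rewrite setD_eq0; apply: contra nAB => AB; rewrite eqEcard AB A3 B3.
have aAB : a \in A :\: B by rewrite inE aB.
have ax : a != x by apply: contraNneq aB => ->.
have /cards1P[b eb] : #|A :\ x :\ a| == 1.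
  by move: A3; rewrite (cardsD1 x) xA (cardsD1 a) in_setD1 ax aA => -[] /eqP.
have AE : A :\ x = [set a; b] by rewrite -eb setD1K // !inE ax.
case: (block a aAB) => [|[S [SC0 tS aS]]]; first by exists a.
(* If [b] is in [B], then [a] is the only candidate, but its blocking family already covers both
   [A :\ x] and [B :\ x]. *)
have [bB|bB] := boolP (b \in B).
  have bx : b != x by have : b \in A :\ x by [rewrite AE !inE eqxx orbT]; rewrite !inE => /andP[].
  case: (final S) => //; last by apply: subset_trans aS; apply: subsetUr.
  apply: subset_trans aS; rewrite AE; apply/subsetP=> z; rewrite !inE.
  by case/orP=> /eqP->; rewrite ?eqxx // bx bB orbT.
have bAB : b \in A :\: B.
  have : b \in A :\ x by rewrite AE !inE eqxx orbT.
  by rewrite !inE bB => /andP[].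
case: (block b bAB) => [|[S' [S'C0 tS' bS']]]; first by exists b.
case: (final (S :|: S')); rewrite ?subUset ?SC0 //.
- have [SC S'C] := (subset_trans SC0 C0C, subset_trans S'C0 C0C).
  apply: (tight_setU spC SC S'C tS tS').
  apply: (@leq_trans #|B :\ x|); first by rewrite B2.
  apply: subset_leq_card; rewrite subsetI.
  by rewrite (subset_trans _ aS) ?(subset_trans _ bS') ?subsetUr.
- rewrite AE coverU; apply: setUSS; rewrite sub1set.
    by apply: (subsetP aS); rewrite setU11.
  by apply: (subsetP bS'); rewrite setU11.
by rewrite coverU (subset_trans _ (subsetUl _ _)) // (subset_trans _ aS) ?subsetUr.
Qed.

Lemma realizes_pair Z : #|Z| = 2 -> realizes Z set0.
Proof.
move/eqP/cards2P=> [y [z [nyz ->]]].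
have dne b : [set w | b != w] = [set ~~ b].
  by apply/setP=> c; rewrite !inE; case: b c => [] [].
have lT : leaves (fun b c : bool => b != c) = setT.
  by apply/setP=> b; rewrite !inE /degree dne cards1.
exists bool, (fun b c => b != c), (fun u => u == y); split.
- split=> [b c|b||b c|p /andP[_ /card_uniqP <-]]; rewrite ?eqxx ?card_bool //.
  + by rewrite eq_sym.
  + have [->|bc] := eqVneq b c; [exact: connect0 | exact: connect1].
  + by rewrite -card_bool max_card.
- move=> u v; rewrite !inE => /orP[]/eqP-> /orP[]/eqP-> //;
  by rewrite eqxx eq_sym (negPf nyz).
- rewrite lT; apply/esym/setP=> -[]; rewrite !inE; apply/imsetP.
    by exists y; rewrite ?eqxx ?inE ?eqxx.
  by exists z; rewrite ?inE ?eqxx ?orbT // eq_sym (negPf nyz).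
- by move=> b; rewrite lT inE.
by move=> b; rewrite in_setC lT inE.
Qed.

(** Otherwise there are at least 3(n + 2) incidences, while [n] triples give 3n. *)
Lemma exists_low_degree Z C n : #|Z| = n.+2 -> #|C| = n ->
  (forall t, t \in C -> #|t| = 3) -> (forall t, t \in C -> t \subset Z) ->
  exists2 x, x \in Z & #|[set t in C | x \in t]| <= 2.
Proof.
move=> cZ cC C3 CZ.
case: (boolP [forall x in Z, 3 <= #|[set t in C | x \in t]|]); last first.
  rewrite negb_forall_in => /exists_inP[x xZ]; rewrite -ltnNge ltnS => x2.
  by exists x.
move/forall_inP=> deg3.
have le : \sum_(x in Z) 3 <= \sum_(x in Z) #|[set t in C | x \in t]|.
  exact: leq_sum.
have eqs : \sum_(x in Z) #|[set t in C | x \in t]| = \sum_(t in C) 3.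
  under eq_bigr do rewrite -sum1dep_card big_mkcondr.
  rewrite exchange_big /=; apply: eq_bigr => t tC.
  rewrite -(C3 t tC) -sum1_card [RHS](big_setID Z) /=.
  rewrite (setIidPl (CZ t tC)) -big_mkcondr /=.
  have -> : t :\: Z = set0 by apply/eqP; rewrite setD_eq0 CZ.
  rewrite big_set0 addn0; apply: eq_bigl => x.
  by apply/andb_idl/(subsetP (CZ t tC)).
by move: le; rewrite eqs !sum_nat_const cZ cC; lia.
Qed.

Lemma sparse_realizes Z C n : #|Z| = n.+2 -> #|C| = n ->
  (forall t, t \in C -> #|t| = 3) -> (forall t, t \in C -> t \subset Z) ->
  sparse C -> realizes Z C.
Proof.
elim: n Z C => [|n IHn] Z C cZ cC C3 CZ spC.
  by rewrite (cards0_eq cC); apply: realizes_pair.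
have [x xZ deg2] := exists_low_degree cZ cC C3 CZ.
have cZx : #|Z :\ x| = n.+2 by move: cZ; rewrite (cardsD1 x) xZ => -[].
have C_neq0 : C != set0 by rewrite -card_gt0 cC.
have subx t : t \in C -> x \notin t -> t \subset Z :\ x.
  by move=> tC xt; rewrite subsetD1 xt CZ.
have degx t : (t \in [set t in C | x \in t]) = (t \in C) && (x \in t).
  by rewrite inE.
case: (ltngtP #|[set t in C | x \in t]| 1) => [deg0|deg2'|deg1].
(* If no triple contains [x], then n + 1 triples are covered by n + 2 points, one fewer than
   sparsity demands. *)
- move: deg0; rewrite ltnS leqn0 cards_eq0 => /eqP deg0.
  have := spC C (subxx _) C_neq0.
  have : cover C \subset Z :\ x.
    apply/bigcupsP=> t tC; apply: subx => //; apply/negP=> xt.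
    by have := degx t; rewrite deg0 inE tC xt.
  by move/subset_leq_card; rewrite cC cZx; lia.
- have /cards2P[A [B [nAB eAB]]] : #|[set t in C | x \in t]| == 2.
    by rewrite eqn_leq deg2.
  have /andP[AC xA] : (A \in C) && (x \in A) by rewrite -degx eAB !inE eqxx.
  have /andP[BC xB] : (B \in C) && (x \in B) by rewrite -degx eAB !inE eqxx orbT.
  have xC0 t : t \in C :\ A :\ B -> x \notin t.
    rewrite !inE => /and3P[tB tA tC]; apply/negP=> xt.
    by have := degx t; rewrite eAB tC xt !inE (negPf tA) (negPf tB).
  have C0C : C :\ A :\ B \subset C.
    by apply: subset_trans (subsetDl _ _) (subsetDl _ _).
  have [a /setDP[aA aB] good] :=
    sparse_merge spC AC BC nAB (C3 A AC) (C3 B BC) xA xB.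
  have ax : a != x by apply: contraNneq aB => ->.
  set t' := a |: B :\ x in good.
  have t'3 : #|t'| = 3.
    rewrite cardsU1 !inE (negPf aB) andbF /=.
    by have := C3 B BC; rewrite (cardsD1 x) xB.
  have t'Z : t' \subset Z :\ x.
    rewrite subUset sub1set !inE ax (subsetP (CZ A AC)) //=.
    by apply: setSD; apply: CZ.
  (* The merged triple is new, since [good] applied to it alone would give 4 <= 3. *)
  have t'C0 : t' \notin C :\ A :\ B.
    apply/negP=> t'C0; have := good [set t']; rewrite sub1set => /(_ t'C0).
    by rewrite cards1 cover1 setUid t'3.
  have C1Z t : t \in t' |: C :\ A :\ B -> t \subset Z :\ x.
    case/setU1P=> [->//|tC0]; apply: subx (xC0 t tC0); exact: (subsetP C0C).
  apply: (@realizes_cherry Z C (t' |: C :\ A :\ B) x a A) => //.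
  + by rewrite (subsetP (CZ A AC)).
  + exact: C3.
  + exact: CZ.
  + move=> t /setU1P[->|tC0]; [right | left; exact: (subsetP C0C)].
    rewrite setU11 setU1K ?setD1K // !inE (negPf aB); by rewrite andbF.
  apply: IHn => //.
  + rewrite cardsU1 t'C0; move: cC; rewrite (cardsD1 A) AC (cardsD1 B).
    by rewrite in_setD1 eq_sym nAB BC => -[].
  + by move=> t /setU1P[->//|tC0]; apply: C3; apply: (subsetP C0C).
  move=> D DC1 D0; have [t'D|t'D] := boolP (t' \in D).
    rewrite -(setD1K t'D) cover_setU1 cardsU1 setD11 /=.
    have := good (D :\ t'); rewrite [cover _ :|: _]setUC subDset => /(_ DC1).
    by rewrite [1 + _]addnC -addnA.
  apply: spC => //; apply: subset_trans C0C; apply/subsetP=> t tD.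
  by case/setU1P: (subsetP DC1 t tD) => // et; rewrite -et tD in t'D.
have /cards1P[A eA] : #|[set t in C | x \in t]| == 1 by rewrite deg1.
have /andP[AC xA] : (A \in C) && (x \in A) by rewrite -degx eA inE.
have [a /setD1P[ax aA]] : exists a, a \in A :\ x.
  by apply/card_gt0P; have := C3 A AC; rewrite (cardsD1 x) xA add1n => -[->].
have C1C : C :\ A \subset C := subsetDl _ _.
have C1Z t : t \in C :\ A -> t \subset Z :\ x.
  case/setD1P=> tA tC; apply: subx => //; apply/negP=> xt.
  by have := degx t; rewrite eA tC xt inE (negPf tA).
apply: (@realizes_cherry Z C (C :\ A) x a A) => //.
- by rewrite (subsetP (CZ A AC)).
- exact: C3.
- exact: CZ.
- by move=> t tC1; left; apply: (subsetP C1C).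
apply: IHn => //.
- by move: cC; rewrite (cardsD1 A) AC => -[].
- by move=> t tC1; apply: C3; apply: (subsetP C1C).
exact: sparse_sub spC.
Qed.

End Realization.

(** * Equality in the union bound and disjointness *)

Section Unions.
Variables (I T : finType) (P : {set I}) (F : I -> {set T}).

Lemma leq_card_bigcup : #|\bigcup_(i in P) F i| <= \sum_(i in P) #|F i|.
Proof.
elim/big_rec2: _ => [|i n U _ leUn]; first by rewrite cards0.
by apply: leq_trans (leq_card_setU _ _) _; rewrite leq_add2l.
Qed.

Lemma card_bigcup_disjoint :
  {in P &, forall i j, i <> j -> F i :&: F j = set0} ->
  #|\bigcup_(i in P) F i| = \sum_(i in P) #|F i|.
Proof.
(* Indices outside [P] get the empty set, so that disjointness holds for all pairs. *)
move=> disF; pose G i := if i \in P then F i else set0.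
have -> : \bigcup_(i in P) F i = \bigcup_i G i by rewrite big_mkcond.
rewrite -sum1_card partition_disjoint_bigcup => [|i j nij]; last first.
  rewrite -setI_eq0 /G; case: ifP => iP; last by rewrite set0I.
  by case: ifP => jP; rewrite ?setI0 // disF //; apply/eqP.
rewrite [RHS]big_mkcond; apply: eq_bigr => i _; rewrite sum1_card /G.
by case: ifP; rewrite ?cards0.
Qed.

(** An overlap of [F i] and [F j] would make the union bound strict. *)
Lemma sum_leq_bigcup_disjoint :
  \sum_(i in P) #|F i| <= #|\bigcup_(i in P) F i| ->
  {in P &, forall i j, i <> j -> F i :&: F j = set0}.
Proof.
move=> le i j iP jP /eqP nij; apply/eqP; rewrite -cards_eq0 -leqn0.
move: le; rewrite eq_sym in nij.
have jPi : (j \in P) && (j != i) by rewrite jP.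
rewrite !(bigD1 i iP) /= !(bigD1 j jPi) /= setUA => le.
have {le} := leq_trans le (leq_card_setU _ _).
have: #|\bigcup_(k | (k \in P) && (k != i) && (k != j)) F k|
        <= \sum_(k | (k \in P) && (k != i) && (k != j)) #|F k|.
  elim/big_rec2: _ => [|k n U _ leUn]; first by rewrite cards0.
  by apply: leq_trans (leq_card_setU _ _) _; rewrite leq_add2l.
have := cardsUI (F i) (F j); clear.
move: #|\bigcup_(k | _) F k| (\sum_(k | _) #|F k|) => m n; lia.
Qed.

End Unions.

(** * Refining a family of sets to a sparse family of triples *)

Section Refinement.
Variable X : finType.
Implicit Types (Y t : {set X}) (C D T : {set {set X}}).

(** The triples {a, b, y} for fixed [a], [b]: a non-empty subfamily covers [a], [b] and one private
    point per member. *)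
Lemma fan_of_triples Y : 2 < #|Y| -> exists T,
  [/\ #|T| = #|Y| - 2, forall t, t \in T -> #|t| = 3,
      forall t, t \in T -> t \subset Y & sparse T].
Proof.
move=> Y3; have [a [b [aY bY nab]]] := card_gt1P (ltnW Y3).
pose f y := [set a; b] :|: [set y]; pose W := Y :\: [set a; b].
have f3 y : y \notin [set a; b] -> #|f y| = 3.
  by move=> yab; rewrite /f setUC cardsU1 yab cards2 nab.
have cW : #|W| = #|Y| - 2.
  rewrite cardsD (setIidPr _) ?cards2 ?nab //.
  by apply/subsetP=> z; rewrite !inE => /orP[]/eqP->.
have fK y : y \notin [set a; b] -> f y :\: [set a; b] = [set y].
  move=> yab; rewrite /f setDUl setDv set0U; apply/setDidPl.
  by rewrite disjoints1.
exists (f @: W); split.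
- rewrite card_in_imset // => y z /setDP[_ yab] /setDP[_ zab] efyz.
  by apply: set1_inj; rewrite -(fK y yab) -(fK z zab) efyz.
- by move=> t /imsetP[y /setDP[_ yab] ->]; apply: f3.
- move=> t /imsetP[y /setDP[yY yab] ->]; apply/subsetP=> z; rewrite !inE -orbA.
  by case/or3P=> /eqP->.
move=> D DT /set0Pn[t tD].
have abD : [set a; b] \subset cover D.
  have /imsetP[y _ et] := subsetP DT t tD; apply: subset_trans (bigcup_sup t tD).
  by rewrite et subsetUl.
have DW : D \subset f @: (cover D :\: [set a; b]).
  apply/subsetP=> u uD; have /imsetP[y /setDP[yY yab] eu] := subsetP DT u uD.
  apply/imsetP; exists y => //; apply/setDP; split=> //; apply/bigcupP; exists u => //.
  by rewrite eu !inE eqxx orbT.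
have := leq_trans (subset_leq_card DW) (leq_imset_card _ _).
rewrite cardsD (setIidPr abD) cards2 nab.
by have := subset_leq_card abD; rewrite cards2 nab /=; clear; lia.
Qed.

(** Given [D], let [Z Y] be the part of [Y] covered by its triples in [D]. Sparsity of each fan
    gives |D ∩ F Y| + |Y \ Z Y| <= |Y| - 2; sum this over the sets [Y] that contribute and compare
    with the inequality for these [Y], whose union is covered by that of [D] and the sets Y \ Z
    Y. *)
Lemma sparse_refinement C :
  (forall Y, Y \in C -> 2 < #|Y|) ->
  (forall D, D \subset C -> D != set0 ->
     \sum_(Y in D) (#|Y| - 2) <= #|cover D| - 2) ->
  exists T, [/\ #|T| = \sum_(Y in C) (#|Y| - 2),
    forall t, t \in T -> #|t| = 3,
    forall t, t \in T -> exists2 Y, Y \in C & t \subset Y & sparse T].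
Proof.
move=> C3 thinC.
have /fin_all_exists[F FP] : forall Y, exists T, Y \in C ->
    [/\ #|T| = #|Y| - 2, forall t, t \in T -> #|t| = 3,
        forall t, t \in T -> t \subset Y & sparse T].
  move=> Y; have [YC|] := boolP (Y \in C); last by exists set0.
  by have [T TP] := fan_of_triples (C3 Y YC); exists T.
(* The inequality for two sets bounds their overlap by two, so distinct fans share no triple and
   their sizes add up. *)
have meet2 Y Y' : Y \in C -> Y' \in C -> Y <> Y' -> #|Y :&: Y'| <= 2.
  move=> YC Y'C nYY'; have := thinC [set Y; Y'].
  rewrite subUset !sub1set YC Y'C => /(_ isT).
  have -> : [set Y; Y'] != set0 by apply/set0Pn; exists Y; rewrite !inE eqxx.
  rewrite big_setU1 ?inE ?big_set1 /=; last exact/eqP.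
  rewrite /cover big_setU1 ?inE ?big_set1 /=; last exact/eqP.
  move/(_ isT); have := cardsUI Y Y'; have := C3 Y YC; have := C3 Y' Y'C.
  by clear; lia.
exists (\bigcup_(Y in C) F Y); split.
- rewrite card_bigcup_disjoint => [|Y Y' YC Y'C nYY'].
    by apply: eq_bigr => Y YC; have [] := FP Y YC.
  apply/eqP; rewrite -subset0; apply/subsetP=> t /setIP[tY tY'].
  have [_ /(_ t tY) t3 /(_ t tY) tsY _] := FP Y YC.
  have [_ _ /(_ t tY') tsY' _] := FP Y' Y'C.
  have := meet2 Y Y' YC Y'C nYY'; rewrite leqNgt -t3 subset_leq_card //.
  by rewrite subsetI tsY.
- by move=> t /bigcupP[Y YC tY]; have [_ ->] := FP Y YC.
- by move=> t /bigcupP[Y YC tY]; exists Y => //; have [_ _ ->] := FP Y YC.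
move=> D DF D0; pose C' := [set Y in C | D :&: F Y != set0].
pose Z Y := cover (D :&: F Y).
have C'C : C' \subset C by apply/subsetP=> Y; rewrite inE => /andP[].
have C'P Y : Y \in C' -> [/\ Y \in C, #|D :&: F Y| + 2 <= #|Z Y| & Z Y \subset Y].
  rewrite inE => /andP[YC DFY0]; have [_ _ FY spF] := FP Y YC; split=> //.
    by apply: spF; rewrite ?subsetIr.
  by apply/bigcupsP=> t /setIP[_ /FY].
have DE : D \subset \bigcup_(Y in C') (D :&: F Y).
  apply/subsetP=> t tD; have /bigcupP[Y YC tY] := subsetP DF t tD.
  apply/bigcupP; exists Y; rewrite !inE ?tD // YC; apply/set0Pn; exists t.
  by rewrite inE tD.
have C'0 : C' != set0.
  have [t tD] := set0Pn _ D0; have /bigcupP[Y YC' _] := subsetP DE t tD.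
  by apply/set0Pn; exists Y.
have leD := leq_trans (subset_leq_card DE) (leq_card_bigcup _ _).
have coverC' : cover C' \subset cover D :|: \bigcup_(Y in C') (Y :\: Z Y).
  apply/bigcupsP=> Y YC'; apply/subsetP=> z zY; rewrite inE.
  have [zZ|zZ] := boolP (z \in Z Y); apply/orP; [left|right].
    by apply: subsetP zZ; apply/subset_cover/subsetIl.
  by apply/bigcupP; exists Y => //; rewrite inE zZ.
have leC' := leq_trans (subset_leq_card coverC') (leq_card_setU _ _).
have leS := leq_card_bigcup C' (fun Y => Y :\: Z Y).
have terms : \sum_(Y in C') #|D :&: F Y| + \sum_(Y in C') #|Y :\: Z Y|
               <= \sum_(Y in C') (#|Y| - 2).
  rewrite -big_split; apply: leq_sum => Y /C'P[_ le2 ZY].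
  have := subset_leq_card ZY; rewrite cardsD (setIidPr ZY) /=.
  by move: #|_ :&: _| #|Z Y| #|Y| le2; clear; lia.
(* This ensures that the subtraction in |cover C'| - 2 does not truncate. *)
have C'3 : 2 < #|cover C'|.
  have [Y YC'] := set0Pn _ C'0; have [/C3 Y3 _ _] := C'P Y YC'.
  by apply: leq_trans Y3 (subset_leq_card (bigcup_sup Y YC')).
have := thinC C' C'C C'0; move: leD leC' leS terms C'3; clear.
lia.
Qed.

End Refinement.

(** * Counting medians in leaf-labelled trees *)

Section MedianSystems.
Variables (X V : finType) (e : rel V) (lab : X -> V).
Hypotheses (e_tree : is_tree e) (lab_inj : injective lab).
Hypothesis leaves_lab : leaves e = lab @: [set: X].
Hypothesis deg3 : forall v, v \notin leaves e -> degree e v = 3.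

Lemma lab_sub_leaves (Y : {set X}) : lab @: Y \subset leaves e.
Proof. by rewrite leaves_lab imsetS ?subsetT. Qed.

Lemma card_med_lab (Y : {set X}) : #|med e (lab @: Y)| = #|Y| - 2.
Proof.
rewrite -(card_imset _ lab_inj); apply: card_med (lab_sub_leaves Y) => // v.
by have [|/deg3->//] := boolP (v \in leaves e); rewrite inE => /eqP->.
Qed.

Lemma med_lab_sub_interior (Y : {set X}) : med e (lab @: Y) \subset interior e.
Proof. exact: med_sub_interior (lab_sub_leaves Y). Qed.

(** The disjoint sets of medians all lie among the |cover C| - 2 medians of the union. *)
Lemma disjoint_med_sparse (C : {set {set X}}) :
  {in C &, forall Y Y' : {set X}, Y <> Y' -> med e (lab @: Y) :&: med e (lab @: Y') = set0} ->
  \sum_(Y in C) (#|Y| - 2) <= #|cover C| - 2.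
Proof.
move=> dis; rewrite -card_med_lab; under eq_bigr do rewrite -card_med_lab.
rewrite -card_bigcup_disjoint //; apply/subset_leq_card/bigcupsP=> Y YC.
by apply/medS/imsetS; apply: bigcup_sup.
Qed.

(** The full leaf set already has |X| - 2 medians, all interior; the union bound does the rest. *)
Lemma interior_med_tight (C : {set {set X}}) :
  \bigcup_(Y in C) med e (lab @: Y) = interior e ->
  #|X| - 2 <= \sum_(Y in C) (#|Y| - 2).
Proof.
move=> cov; rewrite -cardsT -card_med_lab.
apply: leq_trans (subset_leq_card (med_lab_sub_interior _)) _.
rewrite -cov; under [leqRHS]eq_bigr do rewrite -card_med_lab.
exact: leq_card_bigcup.
Qed.

(** There are at least |X| - 2 interior vertices, so covering them forces equality in the union
    bound. *)
Lemma interior_med_disjoint (C : {set {set X}}) :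
  \bigcup_(Y in C) med e (lab @: Y) = interior e ->
  \sum_(Y in C) (#|Y| - 2) <= #|X| - 2 ->
  {in C &, forall Y Y' : {set X}, Y <> Y' -> med e (lab @: Y) :&: med e (lab @: Y') = set0}.
Proof.
move=> cov le; apply: (@sum_leq_bigcup_disjoint _ _ C (fun Y => med e (lab @: Y))).
under eq_bigr do rewrite card_med_lab.
apply: leq_trans le _; rewrite cov -cardsT -card_med_lab.
exact/subset_leq_card/med_lab_sub_interior.
Qed.

End MedianSystems.

Theorem theorem2p1 (X : finType) (C : {set {set X}})
    (C_neq0 : C != set0)
    (C_card : forall Y : {set X}, Y \in C -> 3 <= #|Y|)
    (C_cover : cover C = [set: X]) :
  (exists (V : finType) (e : rel V) (lab : X -> V),
     [/\ is_tree e,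
         injective lab /\ leaves e = lab @: [set: X],
         (forall v : V, v \notin leaves e -> degree e v = 3),
         (forall Y Y' : {set X}, Y \in C -> Y' \in C -> Y <> Y' ->
            med e (lab @: Y) :&: med e (lab @: Y') = set0) &
         \bigcup_(Y in C) med e (lab @: Y) = interior e])
  <->
  ((forall C' : {set {set X}}, C' \subset C -> C' != set0 ->
      \sum_(Y in C') (#|Y| - 2) <= #|cover C'| - 2) /\
   #|cover C| - 2 = \sum_(Y in C) (#|Y| - 2)).
Proof.
split=> [[V [e [lab [e_tree [lab_inj leaves_lab] deg3 dis cov]]]]|[thinC tightC]].
  have thin (C' : {set {set X}}) : C' \subset C -> \sum_(Y in C') (#|Y| - 2) <= #|cover C'| - 2.
    move/subsetP=> C'C; apply: (disjoint_med_sparse e_tree lab_inj) => //.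
    by move=> Y Y' /C'C YC /C'C Y'C; apply: dis.
  split=> [C' C'C _|]; first exact: thin.
  apply/eqP; rewrite eqn_leq thin // andbT C_cover cardsT.
  exact: (interior_med_tight e_tree lab_inj).
have [T [cT T3 TC spT]] := sparse_refinement C_card thinC.
have X3 : 2 < #|X|.
  have [Y YC] := set0Pn _ C_neq0; exact: leq_trans (C_card Y YC) (max_card _).
(* Equality for the whole of [C] becomes the exact count of triples required by
   [sparse_realizes]. *)
have cX : #|[set: X]| = (#|T|).+2.
  by rewrite cT -tightC C_cover cardsT; move: X3; clear; lia.
have [|V [e [lab [e_tree lab_inj leaves_lab deg3 meds]]]] :=
  sparse_realizes cX erefl T3 _ spT; first by move=> t _; apply: subsetT.
have {}lab_inj : injective lab by move=> x y; apply: lab_inj; rewrite inE.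
(* Each interior vertex is the median of some triple in [T], hence a median of the member of [C]
   containing that triple. *)
have cov : \bigcup_(Y in C) med e (lab @: Y) = interior e.
  apply/eqP; rewrite eqEsubset; apply/andP; split.
    apply/bigcupsP=> Y _; exact: med_lab_sub_interior.
  apply/subsetP=> v /meds[t tT vt]; have [Y YC tY] := TC t tT.
  apply/bigcupP; exists Y => //; rewrite inE; apply/existsP; exists (lab @: t).
  have t3 : #|lab @: t| = 3 by rewrite card_imset ?T3.
  rewrite imsetS // t3; apply/is_medianP; rewrite ?t3 //.
    exact: lab_sub_leaves.
  move=> _ _ /imsetP[a at_ ->] /imsetP[b bt ->] nab.
  by apply: vt => //; apply: contraNneq nab => ->.
exists V, e, lab; split=> //; apply: interior_med_disjoint => //.
by rewrite -tightC C_cover cardsT.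
Qed.
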